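(* Let $N\geq 2$, let $\mathcal{P},\mathcal{M}$ be nonempty disjoint sets with $\mathcal{P}\cup\mathcal{M}=\{1,\dots,N\}$, and let $A\in\mathbb{R}^{n\times n}$, $B\in\mathbb{R}^{n\times m}$, $C_i\in\mathbb{R}^{p_i\times n}$ for $i\in\{1,\dots,N\}$, where all eigenvalues of $A$ have negative real part and $(A,B)$ is controllable. Consider $$\dot x(t)=Ax(t)+Bu(t),\quad x(0)=0,\quad y_i(t)=C_ix(t),\quad i\in\{1,\dots,N\}$$ (i.e. $D_i=0$ for all $i$). Let $Q_i=Q_i^\top\succeq0$ ($i\in\mathcal{P}$), $R_j=R_j^\top\succeq0$ and $\delta_j>0$ ($j\in\mathcal{M}$). Consider $$(\mathrm{OP})\qquad\sup_{u\in\mathcal{L}_2^0}\ \frac1{|\mathcal{P}|}\sum_{i\in\mathcal{P}}\int_0^\infty y_i(t)^\top Q_iy_i(t)\,dt\quad\text{s.t.}\quad\int_0^\infty y_j(t)^\top R_jy_j(t)\,dt\le\delta_j\quad\forall j\in\mathcal{M},$$ and the semidefinite program $$(\mathrm{SDP})\qquad\min_{\bm{\gamma},P}\ \sum_{j\in\mathcal{M}}\gamma_j\delta_j\quad\text{s.t.}\quad\begin{bmatrix}A^\top P+PA+\Gamma & PB \\ B^\top P & 0\end{bmatrix}\preceq0,\quad\bm{\gamma}\ge0,\quad\Gamma=\frac1{|\mathcal{P}|}\sum_{i\in\mathcal{P}}C_i^\top Q_iC_i-\sum_{j\in\mathcal{M}}\gamma_jC_j^\top R_jC_j,$$ where $P=P^\top\in\mathbb{R}^{n\times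 n}$ (not required to be semidefinite) and $\bm{\gamma}\in\mathbb{R}^{|\mathcal{M}|}$ is the vertically stacked vector of the $\gamma_j$, with $\bm\gamma\ge 0$ elementwise. Let $\Sigma_p$ and $\Sigma_m$ denote the state-space systems with state equation $\dot x(t)=Ax(t)+Bu(t)$, $x(0)=0$, input $u$, and output vectors $$y_p=\frac1{\sqrt{|\mathcal{P}|}}\operatorname{col}_{i\in\mathcal{P}}\big(\sqrt{Q_i}\,y_i\big),\qquad y_m=\operatorname{col}_{j\in\mathcal{M}}\big(\sqrt{R_j}\,y_j\big),$$ respectively. Then: (a) The value of $(\mathrm{OP})$ is upper bounded by the value of $(\mathrm{SDP})$. (b) If $\Sigma_m$ has a zero on the imaginary axis that is not a zero of $\Sigma_p$, then the value of $(\mathrm{SDP})$ is unbounded (equal to $+\infty$).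
   Context: $\mathcal{L}_2^0$ is the set of signals $u:\mathbb{R}_+\to\mathbb{R}^m$ with $\int_0^\infty u(t)^\top u(t)\,dt<\infty$ and $\lim_{t\to\infty}u(t)=0$. $\operatorname{col}$ denotes vertical stacking and $\sqrt{Q}$ the symmetric positive semidefinite square root. Zeros: $\beta\in\mathbb{C}$ is a (finite, invariant) zero of $\Sigma=(A,B,C,D)$ if there exist $x_0$ (of dimension $n$) and $g$ (of dimension $m$), complex-valued in general and not both zero, such that $\begin{bmatrix}\beta I-A & B \\ C & -D\end{bmatrix}\begin{bmatrix}x_0 \\ g\end{bmatrix}=\begin{bmatrix}0 \\ 0\end{bmatrix}$. Conventions: the value of a minimization problem with empty feasible set is $+\infty$ (this is what ''unbounded'' means for a minimization problem here). *)

(* Defs.v *)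
From HB Require Import structures.
From mathcomp Require Export all_boot all_order all_algebra.
From mathcomp Require Export all_classical all_reals all_analysis.
From mathcomp Require Export complex.

Set Implicit Arguments.
Unset Strict Implicit.
Unset Printing Implicit Defensive.

Import Order.TTheory GRing.Theory Num.Theory.
Import numFieldNormedType.Exports.

Local Open Scope classical_set_scope.
Local Open Scope ring_scope.

Section Matrices.
Context {R : realType}.

Definition psdmx k (S : 'M[R]_k) : Prop :=
  S^T = S /\ forall v : 'cV[R]_k, 0 <= (v^T *m S *m v) 0 0.

Definition nsdmx k (S : 'M[R]_k) : Prop :=
  S^T = S /\ forall v : 'cV[R]_k, (v^T *m S *m v) 0 0 <= 0.

(* The positive semidefinite square root, selected by its defining property;
   the default value 0 is only returned when no such root exists. *)
Definition sqrtmx k (S : 'M[R]_k) : 'M[R]_k :=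
  xget 0 [set T : 'M[R]_k | psdmx T /\ T *m T = S].

Definition complexmx k l (S : 'M[R]_(k, l)) : 'M[R[i]]_(k, l) :=
  map_mx (real_complex R) S.

(* The spectrum is taken over R[i]; [eigenvalue] refers to left eigenvectors,
   which have the same eigenvalues as right ones. *)
Definition hurwitz n (A : 'M[R]_n) : Prop :=
  forall l : R[i], eigenvalue (complexmx A) l -> complex.Re l < 0.

Definition is_zero n m p (A : 'M[R]_n) (B : 'M[R]_(n, m))
    (C : 'M[R]_(p, n)) (D : 'M[R]_(p, m)) (beta : R[i]) : Prop :=
  exists (x0 : 'cV[R[i]]_n) (g : 'cV[R[i]]_m),
    ~ (x0 = 0 /\ g = 0) /\
    block_mx (beta%:M - complexmx A) (complexmx B)
             (complexmx C) (- complexmx D) *m col_mx x0 g = 0.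

End Matrices.

Section Signals.
Context {R : realType}.

(* Signals on R_+ are functions on R of which only the values on [0, +oo[
   matter. *)
Definition square_integrable m (u : R -> 'cV[R]_m) : Prop :=
  (forall i : 'I_m, measurable_fun (`[0, +oo[ : set R) (fun t => u t i 0)) /\
  (\int[lebesgue_measure]_(t in `[0%R, +oo[)
     (((u t)^T *m u t) 0 0)%R%:E < +oo)%E.

Definition L20 m (u : R -> 'cV[R]_m) : Prop :=
  square_integrable u /\ u t @[t --> +oo] --> (0 : 'cV[R]_m).

(* Since u need not be continuous, x' = A x + B u with x(0) = x0 is read in the
   sense of Caratheodory: x is continuous and satisfies the integrated equation
   (in Lebesgue's sense), componentwise. *)
Definition trajectory n m (A : 'M[R]_n) (B : 'M[R]_(n, m)) (x0 : 'cV[R]_n)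
    (u : R -> 'cV[R]_m) (x : R -> 'cV[R]_n) : Prop :=
  {within `[0, +oo[, continuous x} /\
  forall (t : R) (i : 'I_n), 0 <= t ->
    x t i 0 = x0 i 0 +
      \int[lebesgue_measure]_(s in `[0, t]) ((A *m x s + B *m u s) i 0).

(* Every state can be steered to every other state in finite time. *)
Definition controllable n m (A : 'M[R]_n) (B : 'M[R]_(n, m)) : Prop :=
  forall x0 x1 : 'cV[R]_n, exists T u x,
    [/\ 0 <= T, square_integrable u, trajectory A B x0 u x & x T = x1].

Definition quad_energy p (W : 'M[R]_p) (y : R -> 'cV[R]_p) : \bar R :=
  (\int[lebesgue_measure]_(t in `[0%R, +oo[)
     (((y t)^T *m W *m y t) 0 0)%R%:E)%E.

End Signals.

Section Problems.
Context {R : realType} {N n m : nat} {p : 'I_N -> nat}.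
Variables (PP MM : {set 'I_N}).
Variables (A : 'M[R]_n) (B : 'M[R]_(n, m)) (C : forall i, 'M[R]_(p i, n)).
(* Only the values of Q on PP, and those of S and delta on MM, are used. *)
Variables (Q S : forall i, 'M[R]_(p i)) (delta : 'I_N -> R).

Definition op_objective (x : R -> 'cV[R]_n) : \bar R :=
  ((#|PP|%:R^-1)%:E *
    \sum_(i in PP) quad_energy (Q i) (fun t => C i *m x t))%E.

Definition op_feasible (u : R -> 'cV[R]_m) (x : R -> 'cV[R]_n) : Prop :=
  [/\ L20 u, trajectory A B 0 u x &
    forall j, j \in MM ->
      (quad_energy (S j) (fun t => C j *m x t) <= (delta j)%:E)%E].

Definition op_value : \bar R :=
  ereal_sup [set J | exists u x, op_feasible u x /\ J = op_objective x].

(* The entries of gamma are indexed along the enumeration of MM. *)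
Definition sdp_Gamma (gamma : 'cV[R]_#|MM|) : 'M[R]_n :=
  #|PP|%:R^-1 *: (\sum_(i in PP) (C i)^T *m Q i *m C i) -
  \sum_(k < #|MM|) gamma k 0 *:
    ((C (enum_val k))^T *m S (enum_val k) *m C (enum_val k)).

Definition sdp_feasible (gamma : 'cV[R]_#|MM|) (P : 'M[R]_n) : Prop :=
  [/\ P^T = P,
    nsdmx (block_mx (A^T *m P + P *m A + sdp_Gamma gamma) (P *m B)
                    (B^T *m P)                            0) &
    forall k, 0 <= gamma k 0].

Definition sdp_objective (gamma : 'cV[R]_#|MM|) : R :=
  \sum_(k < #|MM|) gamma k 0 * delta (enum_val k).

(* [ereal_inf set0 = +oo]: an infeasible program has value +oo. *)
Definition sdp_value : \bar R :=
  ereal_inf [set J | exists gamma P,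
    sdp_feasible gamma P /\ J = (sdp_objective gamma)%:E].

End Problems.

Section WeightedOutputs.
Context {R : realType} {N n : nat} {p : 'I_N -> nat}.
Variables (C : forall i, 'M[R]_(p i, n)) (W : forall i, 'M[R]_(p i)).

(* Output matrix of col_{i in I} (sqrt (W i) y_i), where y_i = C i x. *)
Definition stacked_output (I : {set 'I_N}) :
    'M[R]_(\sum_(k < #|I|) p (enum_val k), n) :=
  \mxcol_(k < #|I|) (sqrtmx (W (enum_val k)) *m C (enum_val k)).

End WeightedOutputs.

(* Main.v *)
Require Import Defs.
From mathcomp Require Import ring lra measurable_realfun.

(* Both parts rest on the fact that the zero block of the linear matrix
   inequality forces P B = 0, so that the inequality reduces to
   A^T P + P A + Gamma <= 0.

   (a) Since P B = 0, P x solves (P x)' = P A x and is C^1 although x is not,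
   hence so is the storage function x^T P x, and integrating its derivative
   gives int_0^T x^T Gamma x <= - x(T)^T P x(T).  As A is Hurwitz and u vanishes
   at infinity, x(T) is arbitrarily small for suitable large T: for a norm nu
   with nu ((1 + h A) v) <= (1 - c h) nu v for small h, the sequence
   nu (x (k h)) satisfies a perturbed contraction, because x (t + h) differs
   from (1 + h A) x (t) by O(h^2 |x (t)|) + O(h sup |u|).

   (b) At a zero i w of Sigma_m with state direction x0 = a + i b, P B = 0
   cancels the terms of P A, so that x0^* Gamma x0 <= 0.  Since the measured
   outputs vanish at x0, this forces the performance outputs to vanish there
   too, and i w would be a zero of Sigma_p: no P and gamma are feasible. *)

Set Implicit Arguments.
Unset Strict Implicit.
Unset Printing Implicit Defensive.

Import Order.TTheory GRing.Theory Num.Theory.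
Import numFieldNormedType.Exports.

Local Open Scope ring_scope.

(** * Quadratic forms and complex vectors *)

Section QuadraticForms.
Context {R : realType}.

Definition qform k (M : 'M[R]_k) (v : 'cV[R]_k) : R := (v^T *m M *m v) 0 0.

Lemma qformD k (M M' : 'M[R]_k) v : qform (M + M') v = qform M v + qform M' v.
Proof. by rewrite /qform mulmxDr mulmxDl mxE. Qed.

Lemma qformZ k a (M : 'M[R]_k) v : qform (a *: M) v = a * qform M v.
Proof. by rewrite /qform -scalemxAr -scalemxAl mxE. Qed.

Lemma qformN k (M : 'M[R]_k) v : qform (- M) v = - qform M v.
Proof. by rewrite -scaleN1r qformZ mulN1r. Qed.

Lemma qform_sum k I (r : seq I) (P : pred I) (F : I -> 'M[R]_k) v :
  qform (\sum_(i <- r | P i) F i) v = \sum_(i <- r | P i) qform (F i) v.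
Proof.
apply: (big_morph (fun M => qform M v)) => [M M'|]; first exact: qformD.
by rewrite /qform mulmx0 mul0mx mxE.
Qed.

Lemma qform_mulmx k l (M : 'M[R]_k) (L : 'M[R]_(k, l)) v :
  qform (L^T *m M *m L) v = qform M (L *m v).
Proof. by rewrite /qform trmx_mul !mulmxA. Qed.

(** Throughout, [qform 1%:M] plays the part of the squared Euclidean norm. *)
Lemma qform1E k (v : 'cV[R]_k) : qform 1%:M v = \sum_i v i 0 ^+ 2.
Proof.
by rewrite /qform mulmx1 mxE; apply: eq_bigr => i _; rewrite mxE expr2.
Qed.

Lemma qform1_ge0 k (v : 'cV[R]_k) : 0 <= qform 1%:M v.
Proof. by rewrite qform1E sumr_ge0// => i _; exact: sqr_ge0. Qed.

Lemma qform1_eq0 k (v : 'cV[R]_k) : qform 1%:M v = 0 -> v = 0.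
Proof.
rewrite qform1E => /eqP; rewrite psumr_eq0 => [/allP h|i _]; last exact: sqr_ge0.
apply/matrixP => i j; rewrite ord1 mxE.
by have := h i (mem_index_enum _); rewrite sqrf_eq0 => /eqP.
Qed.

(** With [a] fixed, the form at [col_mx a (s *: b)] is affine in [s] because the lower block is 0.
    It is bounded above only if its slope vanishes, and for [b = E^T *m a] the slope is twice the
    squared norm of [b]. *)
Lemma nsd_block0 n m (K : 'M[R]_n) (E : 'M[R]_(n, m)) :
  nsdmx (block_mx K E E^T 0) -> E = 0 /\ forall v, qform K v <= 0.
Proof.
move=> [_ nsd].
have nsdE a (b : 'cV_m) : qform K a + (a^T *m E *m b) 0 0 *+ 2 <= 0.
  have := nsd (col_mx a b).
  rewrite tr_col_mx mul_row_block mul_row_col mulmx0 addr0 mulmxDl mxE [X in X + _]mxE.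
  suff -> : (b^T *m E^T *m a) 0 0 = (a^T *m E *m b) 0 0 by rewrite -addrA -mulr2n.
  by rewrite -!trace_mx11 -mxtrace_tr !trmx_mul !trmxK mulmxA.
split; last by move=> v; have := nsdE v 0; rewrite mulmx0 mxE mul0rn addr0.
suff Ea0 (a : 'cV_n) : E^T *m a = 0.
  apply/matrixP => i j; have /matrixP/(_ j 0) := Ea0 (delta_mx i 0).
  by rewrite -colE !mxE.
apply: qform1_eq0; set w := E^T *m a.
have h s : qform K a + s * qform 1%:M w *+ 2 <= 0.
  have := nsdE a (s *: w).
  by rewrite -scalemxAr mxE /qform /w trmx_mul trmxK mulmx1.
apply/eqP; rewrite eq_le qform1_ge0 andbT leNgt; apply/negP => w0.
(* At this [s] the affine bound would read [1 <= 0]. *)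
have := h ((1 - qform K a) / (qform 1%:M w *+ 2)).
rewrite -mulrnAr divfK ?gt_eqF ?pmulrn_lgt0//.
by rewrite addrCA subrr addr0 ler10.
Qed.

End QuadraticForms.

Section ComplexParts.
Context {R : realType}.

Definition Remx k l (Z : 'M[R[i]]_(k, l)) : 'M[R]_(k, l) := map_mx (@complex.Re R) Z.
Definition Immx k l (Z : 'M[R[i]]_(k, l)) : 'M[R]_(k, l) := map_mx (@complex.Im R) Z.

Lemma Re_realM (r : R) (z : R[i]) : complex.Re ((real_complex R r) * z) = r * complex.Re z.
Proof. by case: z => a b /=; rewrite mul0r subr0. Qed.

Lemma Im_realM (r : R) (z : R[i]) : complex.Im ((real_complex R r) * z) = r * complex.Im z.
Proof. by case: z => a b /=; rewrite mul0r addr0. Qed.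

Lemma Re_sum I (r : seq I) (F : I -> R[i]) :
  complex.Re (\sum_(i <- r) F i) = \sum_(i <- r) complex.Re (F i).
Proof. by apply: (big_morph (@complex.Re R)) => // [[a b] [c d]]. Qed.

Lemma Im_sum I (r : seq I) (F : I -> R[i]) :
  complex.Im (\sum_(i <- r) F i) = \sum_(i <- r) complex.Im (F i).
Proof. by apply: (big_morph (@complex.Im R)) => // [[a b] [c d]]. Qed.

Lemma Remx_complexM k l p (M : 'M[R]_(k, l)) (Z : 'M[R[i]]_(l, p)) :
  Remx (complexmx M *m Z) = M *m Remx Z.
Proof.
apply/matrixP => i j; rewrite !mxE Re_sum; apply: eq_bigr => a _.
by rewrite !mxE Re_realM.
Qed.

Lemma Immx_complexM k l p (M : 'M[R]_(k, l)) (Z : 'M[R[i]]_(l, p)) :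
  Immx (complexmx M *m Z) = M *m Immx Z.
Proof.
apply/matrixP => i j; rewrite !mxE Im_sum; apply: eq_bigr => a _.
by rewrite !mxE Im_realM.
Qed.

Lemma complexmx_eq0 k l (Z : 'M[R[i]]_(k, l)) : Remx Z = 0 -> Immx Z = 0 -> Z = 0.
Proof.
move=> /matrixP re0 /matrixP im0; apply/matrixP => i j.
have := re0 i j; have := im0 i j; rewrite !mxE.
by case: (Z i j) => a b /= -> ->.
Qed.

Lemma ReD (z w : R[i]) : complex.Re (z + w) = complex.Re z + complex.Re w.
Proof. by case: z w => [a b] [c d]. Qed.

Lemma ImD (z w : R[i]) : complex.Im (z + w) = complex.Im z + complex.Im w.
Proof. by case: z w => [a b] [c d]. Qed.

Lemma Re_imagM (b z : R[i]) : complex.Re b = 0 ->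
  complex.Re (b * z) = - complex.Im b * complex.Im z.
Proof. by case: b z => [b c] [x y] /= ->; rewrite mul0r add0r mulNr. Qed.

Lemma Im_imagM (b z : R[i]) : complex.Re b = 0 ->
  complex.Im (b * z) = complex.Im b * complex.Re z.
Proof. by case: b z => [b c] [x y] /= ->; rewrite mul0r add0r. Qed.

(** With zero feedthrough the output equation concerns the state direction alone, and a real output
    matrix splits it into two real equations. *)
Lemma is_zero_imag n m p (A : 'M[R]_n) (B : 'M[R]_(n, m)) (C : 'M[R]_(p, n))
    (beta : R[i]) (x0 : 'cV[R[i]]_n) (g : 'cV[R[i]]_m) :
  block_mx (beta%:M - complexmx A) (complexmx B)
           (complexmx C) (- complexmx 0) *m col_mx x0 g = 0 <->
  (beta%:M - complexmx A) *m x0 + complexmx B *m g = 0 /\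
  C *m Remx x0 = 0 /\ C *m Immx x0 = 0.
Proof.
rewrite mul_block_col -[in X in _ = X]col_mx0.
have -> : - complexmx 0 *m g = 0 :> 'cV_p by rewrite /complexmx map_mx0 oppr0 mul0mx.
rewrite addr0; split.
  move=> /eq_col_mx[-> h]; split=> //.
  rewrite -Remx_complexM -Immx_complexM h.
  by split; apply/matrixP => i j; rewrite !mxE.
move=> [-> [h1 h2]]; congr col_mx.
by apply: complexmx_eq0; rewrite ?Remx_complexM ?Immx_complexM.
Qed.

(** The state equation says A x0 = beta x0 + B g; for beta = i w, multiplication by beta rotates the
    real and imaginary parts into each other. *)
Lemma zero_state_parts n m (A : 'M[R]_n) (B : 'M[R]_(n, m)) (beta : R[i])
    (x0 : 'cV[R[i]]_n) (g : 'cV[R[i]]_m) : complex.Re beta = 0 ->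
  (beta%:M - complexmx A) *m x0 + complexmx B *m g = 0 ->
  A *m Remx x0 = - complex.Im beta *: Immx x0 + B *m Remx g /\
  A *m Immx x0 = complex.Im beta *: Remx x0 + B *m Immx g.
Proof.
move=> beta0; rewrite mulmxBl mul_scalar_mx addrAC => /eqP; rewrite subr_eq0 => /eqP e.
rewrite -!Remx_complexM -!Immx_complexM -e; split; apply/matrixP => i j.
  by rewrite !mxE ReD Re_imagM.
by rewrite !mxE ImD Im_imagM.
Qed.

End ComplexParts.

(** * Square roots of positive semidefinite matrices *)

Section SquareRoot.
Context {R : realType}.

(** Newton's scheme: a new node [a] is met by adding a multiple of the product of all ['X - y%:P],
    which vanishes at the old nodes and not at [a]. *)
Lemma poly_interpolation (F : fieldType) (s : seq F) (f : F -> F) :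
  exists p : {poly F}, {in s, forall x, p.[x] = f x}.
Proof.
elim: s => [|a s [p ps]]; first by exists 0.
have [as_|as_] := boolP (a \in s).
  by exists p => x; rewrite inE => /orP[/eqP ->|]; exact: ps.
pose q := \prod_(y <- s) ('X - y%:P).
have qa : q.[a] != 0 by apply: contra as_ => qa; rewrite -root_prod_XsubC.
exists (p + ((f a - p.[a]) / q.[a]) *: q) => x; rewrite inE !hornerE.
move=> /orP[/eqP ->|xs]; first by rewrite divfK// addrC subrK.
have /rootP -> : root q x by rewrite root_prod_XsubC.
by rewrite mulr0 addr0 ps.
Qed.

Lemma trmx_horner n (M : 'M[R]_n.+1) p : M^T = M -> (horner_mx M p)^T = horner_mx M p.
Proof.
move=> MT; elim/poly_ind: p => [|p c IH]; first by rewrite !rmorph0 trmx0.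
rewrite rmorphD rmorphM/= horner_mx_X horner_mx_C linearD/= tr_scalar_mx.
by rewrite [_ * M]/GRing.mul/= trmx_mul IH MT; congr (_ + _); apply/esym/comm_horner_mx.
Qed.

(* The root is G^2 for G = g(S), where the real polynomial g interpolates the
   fourth root on the spectrum of S; G is real and symmetric, so G^2 is
   positive semidefinite. *)
Lemma psd_sqrt_exists n (S : 'M[R]_n) :
  psdmx S -> exists T : 'M[R]_n, psdmx T /\ T *m T = S.
Proof.
case: n S => [|n] S [Ssym Spsd].
  exists 0; split; last by rewrite [LHS]flatmx0 [RHS]flatmx0.
  by split => [|v]; rewrite ?trmx0// mulmx0 mul0mx mxE.
pose Sc := complexmx S.
have Sc_herm : Sc \is hermsymmx.
  apply: realsym_hermsym.
    apply/is_hermitianmxP; rewrite expr0 scale1r map_mx_id//.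
    by rewrite /Sc /complexmx map_trmx Ssym.
  by apply/mxOverP => i j; rewrite mxE complex_real.
have /orthomx_spectralP ScE := hermitian_normalmx Sc_herm.
have dreal := hermitian_spectral_diag_real Sc_herm.
set P := spectralmx Sc in ScE; set d := spectral_diag Sc in ScE dreal.
have Punit : P \in unitmx by exact: spectral_unit.
pose r j := complex.Re (d 0 j).
have dE j : d 0 j = real_complex R (r j).
  by rewrite /r RRe_real//; exact: (mxOverP dreal).
(* Column [j] of [invmx P] is a complex eigenvector for [r j]. As [S] and [r j] are real, its real
   and imaginary parts satisfy the same equation, and one of them is nonzero. *)
have r_ge0 j : 0 <= r j.
  pose z : 'cV_n.+1 := invmx P *m delta_mx j 0.
  have Sz : Sc *m z = d 0 j *: z.
    rewrite /z mulmxA ScE mulmxK// mul_mx_diag -colE -colE.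
    by apply/matrixP => i k; rewrite !mxE mulrC.
  have Sre : S *m Remx z = r j *: Remx z.
    rewrite -Remx_complexM [complexmx S *m z]Sz dE.
    by apply/matrixP => i k; rewrite !mxE Re_realM.
  have Sim : S *m Immx z = r j *: Immx z.
    rewrite -Immx_complexM [complexmx S *m z]Sz dE.
    by apply/matrixP => i k; rewrite !mxE Im_realM.
  have eig_ge0 (v : 'cV_n.+1) : S *m v = r j *: v -> v != 0 -> 0 <= r j.
    move=> Sv v0; have := Spsd v.
    rewrite -mulmxA Sv -scalemxAr mxE -[v^T]mulmx1 pmulr_lge0// lt_def qform1_ge0 andbT.
    by apply: contra v0 => /eqP/qform1_eq0 ->.
  have [re0|] := eqVneq (Remx z) 0; last exact: eig_ge0.
  have [im0|] := eqVneq (Immx z) 0; last exact: eig_ge0.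
  have := unitmx_inv P; rewrite Punit => Pinv.
  have z0 := complexmx_eq0 re0 im0.
  have : P *m z = 0 by rewrite z0 mulmx0.
  rewrite /z mulmxA mulmxV// mul1mx => /matrixP/(_ j 0).
  by rewrite !mxE eqxx => /eqP; rewrite oner_eq0.
(* [S] is diagonalizable over [R[i]], so a polynomial that vanishes on its spectrum annihilates it.
   This reduces the identity for the root to a scalar one. *)
have horner0 (p : {poly R}) : (forall j, p.[r j] = 0) -> horner_mx S p = 0.
  move=> p0; have : complexmx (horner_mx S p) = 0.
    rewrite /complexmx map_horner_mx -/(complexmx S) -/Sc ScE.
    rewrite horner_mx_uconjC// horner_mx_diag.
    rewrite (_ : map_mx _ d = 0) ?linear0 ?mulmx0 ?mul0mx//.
    by apply/matrixP => i j; rewrite ord1 !mxE dE horner_map p0 rmorph0.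
  move=> /matrixP h; apply/matrixP => i j; have := h i j.
  by rewrite !mxE => -[].
have [g gE] := poly_interpolation [seq r j | j <- enum 'I_n.+1]
  (fun x => Num.sqrt (Num.sqrt x)).
pose G := horner_mx S g.
have GT : G^T = G by exact: trmx_horner.
exists (G *m G); split; last first.
  have /eqP : horner_mx S (g * g * (g * g) - 'X) = 0.
    apply: horner0 => j; rewrite hornerD hornerN hornerX !hornerM gE.
      by rewrite -!expr2 !sqr_sqrtr ?sqrtr_ge0// subrr.
    by apply/mapP; exists j; rewrite ?mem_enum.
  by rewrite rmorphB !rmorphM/= horner_mx_X subr_eq0 => /eqP.
split; first by rewrite trmx_mul GT.
move=> v; have := qform1_ge0 (G *m v).
by rewrite -qform_mulmx /qform mulmx1 GT.
Qed.

(** Existence of a root rules out the default value of [xget]. *)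
Lemma sqrtmxP n (S : 'M[R]_n) : psdmx S ->
  psdmx (sqrtmx S) /\ sqrtmx S *m sqrtmx S = S.
Proof. by rewrite /sqrtmx => /psd_sqrt_exists[T hT]; case: xgetP => [_ _ //|/(_ T)]. Qed.

End SquareRoot.

(** * Imaginary zeros and infeasibility of the semidefinite program *)

Section Infeasibility.
Context {R : realType} {N n m : nat} {p : 'I_N -> nat}.
Variables (PP MM : {set 'I_N}).
Variables (A : 'M[R]_n) (B : 'M[R]_(n, m)) (C : forall i, 'M[R]_(p i, n)).
Variables (Q S : forall i, 'M[R]_(p i)).
Hypothesis hPP : PP != finset.set0.
Hypothesis hQ : forall i, i \in PP -> psdmx (Q i).
Hypothesis hS : forall j, j \in MM -> psdmx (S j).

(** Links the weighted terms of [sdp_Gamma] to the outputs stacked with square roots. *)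
Lemma psd_qform_sqrt k l (W : 'M[R]_k) (L : 'M[R]_(k, l)) v : psdmx W ->
  qform (L^T *m W *m L) v = qform 1%:M (sqrtmx W *m L *m v).
Proof.
move=> /sqrtmxP[[sT _] sK].
by rewrite -qform_mulmx mulmx1 trmx_mul sT -!mulmxA (mulmxA (sqrtmx W)) sK.
Qed.

Lemma psd_qform_ge0 k l (W : 'M[R]_k) (L : 'M[R]_(k, l)) v : psdmx W ->
  0 <= qform (L^T *m W *m L) v.
Proof. by rewrite qform_mulmx => -[_]; exact. Qed.

Lemma stacked_output_eq0 (W : forall i, 'M[R]_(p i)) (I : {set 'I_N}) (v : 'cV[R]_n) :
  stacked_output C W I *m v = 0 <->
  forall k : 'I_#|I|, sqrtmx (W (enum_val k)) *m C (enum_val k) *m v = 0.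
Proof.
rewrite /stacked_output mxcol_mul; split => [h k|h].
  have /(congr1 (fun M => submxcol M k)) := h.
  by rewrite mxcolK => ->; apply/matrixP => i j; rewrite !mxE.
by under eq_mxcol do rewrite h; apply/matrixP => i j; rewrite !mxE.
Qed.

(** Where the measured outputs vanish, so do all terms weighted by [gamma], whatever its value; only
    the performance energy remains. *)
Lemma Gamma_meas_kernel (gamma : 'cV[R]_#|MM|) v :
  stacked_output C S MM *m v = 0 ->
  qform (sdp_Gamma PP C Q S gamma) v =
  #|PP|%:R^-1 * \sum_(i in PP) qform 1%:M (sqrtmx (Q i) *m C i *m v).
Proof.
move=> /stacked_output_eq0 Sv.
rewrite /sdp_Gamma qformD qformN qformZ !qform_sum [X in _ - X]big1 ?subr0; last first.
  move=> k _; rewrite qformZ psd_qform_sqrt ?Sv; last exact/hS/enum_valP.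
  by rewrite /qform mulmx0 mxE mulr0.
by congr (_ * _); apply: eq_bigr => i iP; rewrite psd_qform_sqrt//; exact: hQ.
Qed.

Lemma card_inv_gt0 : 0 < #|PP|%:R^-1 :> R.
Proof. by rewrite invr_gt0 ltr0n card_gt0. Qed.

(** The scalar [c] accommodates the normalization of [y_p]. The zero direction of [Sigma_m] is
    reused for [Sigma_p]: both share the state equation, so only the performance output has to be
    shown to vanish. *)
Lemma sdp_infeasible_of_zero (c : R) (beta : R[i]) : complex.Re beta = 0 ->
  is_zero A B (stacked_output C S MM) 0 beta ->
  ~ is_zero A B (c *: stacked_output C Q PP) 0 beta ->
  forall (gamma : 'cV[R]_#|MM|) P, ~ sdp_feasible PP A B C Q S gamma P.
Proof.
move=> beta0 [x0 [g [nz]]] /is_zero_imag[h [Ca Cb]] nzp gamma P [PT].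
have -> : B^T *m P = (P *m B)^T by rewrite trmx_mul PT.
move=> /nsd_block0[PB K] _; apply: nzp; exists x0, g; split => //.
apply/is_zero_imag; split=> //.
have [Aa Ab] := zero_state_parts beta0 h.
set a := Remx x0 in Ca Aa Ab *; set b := Immx x0 in Cb Aa Ab *.
(* With w the imaginary part of [beta], a^T P A a = - w a^T P b and b^T P A b = w b^T P a, the input
   terms being removed by [PB]. Symmetry of [P] makes the two cancel in the sum. *)
have /= Gab : qform (sdp_Gamma PP C Q S gamma) a + qform (sdp_Gamma PP C Q S gamma) b <= 0.
  have symPA v : qform (A^T *m P) v = qform (P *m A) v.
    rewrite /qform -!trace_mx11 -mxtrace_tr !trmx_mul !trmxK PT.
    by rewrite !mulmxA.
  have PAE (v w : 'cV[R]_n) : (v^T *m P *m w) 0 0 = (w^T *m P *m v) 0 0.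
    by rewrite -!trace_mx11 -mxtrace_tr !trmx_mul !trmxK PT !mulmxA.
  have PAsub v (s : R) w h' : A *m v = s *: w + B *m h' ->
      qform (P *m A) v = s * (v^T *m P *m w) 0 0.
    move=> e; rewrite /qform !mulmxA -[_ *m A *m v]mulmxA e mulmxDr -scalemxAr.
    by rewrite !mulmxA -[_ *m P *m B]mulmxA PB mulmx0 mul0mx addr0 mxE.
  have := lerD (K a) (K b); rewrite addr0 !qformD !symPA.
  by rewrite (PAsub _ _ _ _ Aa) (PAsub _ _ _ _ Ab) (PAE b a); lra.
have Gge0 (v : 'cV[R]_n) : stacked_output C S MM *m v = 0 ->
    0 <= qform (sdp_Gamma PP C Q S gamma) v.
  move=> /Gamma_meas_kernel ->; apply: mulr_ge0; first exact/ltW/card_inv_gt0.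
  by apply: sumr_ge0 => i _; exact: qform1_ge0.
(* A sum of squared norms that is at most 0 has only zero terms. *)
have Cp0 (v : 'cV[R]_n) : stacked_output C S MM *m v = 0 ->
    qform (sdp_Gamma PP C Q S gamma) v <= 0 -> stacked_output C Q PP *m v = 0.
  move=> Sv; rewrite Gamma_meas_kernel// pmulr_rle0 ?card_inv_gt0// => le0.
  apply/stacked_output_eq0 => k; apply: qform1_eq0; apply: le_anti.
  rewrite qform1_ge0 andbT; apply: le_trans le0.
  rewrite (bigD1 (enum_val k)) ?enum_valP//= lerDl sumr_ge0// => i _.
  exact: qform1_ge0.
(* Two nonnegative values with sum at most 0 are both at most 0. *)
have := Gge0 _ Ca; have := Gge0 _ Cb => Gb Ga.
by rewrite -!scalemxAl !Cp0 ?scaler0//; lra.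
Qed.

End Infeasibility.

(** * Norms contracted by a Hurwitz matrix *)

Section LyapunovNorm.
Context {R : realType}.

Local Notation cabs := (@complex.ComplexField.Normc.normc R).

Lemma cabs_ge0 z : 0 <= cabs z.
Proof. by case: z => a b; exact: sqrtr_ge0. Qed.

Lemma cabsM y z : cabs (y * z) = cabs y * cabs z.
Proof. exact: complex.ComplexField.Normc.normcM. Qed.

Lemma cabsD y z : cabs (y + z) <= cabs y + cabs z.
Proof. exact: complex.le_normcD. Qed.

Lemma cabs0 : cabs 0 = 0.
Proof. exact: complex.ComplexField.Normc.normc0. Qed.

Lemma cabs_real (r : R) : cabs (real_complex R r) = `|r|.
Proof. by rewrite /= expr0n/= addr0 sqrtr_sqr. Qed.

Lemma cabs_sum (I : Type) (r : seq I) (P : pred I) (F : I -> R[i]) :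
  cabs (\sum_(i <- r | P i) F i) <= \sum_(i <- r | P i) cabs (F i).
Proof.
elim/big_rec2 : _ => [|i x y _ h]; first by rewrite cabs0.
by apply: (le_trans (cabsD _ _)); rewrite lerD2l.
Qed.

(** The minimum is started at 1, which also settles the empty family. *)
Lemma finite_pos_lower_bound n (f : 'I_n -> R) : (forall k, 0 < f k) ->
  exists2 c, 0 < c & forall k, c <= f k.
Proof.
move=> f0; exists (\big[Order.min/1]_k f k); last by move=> k; exact: bigmin_le.
by elim/big_ind: _ => // x y x0 y0; rewrite lt_min x0.
Qed.

(** For l = a + i b the bound on [h] gives h |l|^2 <= - a, so |1 + h l|^2 = 1 + 2 h a + h^2 |l|^2 <=
    1 + h a <= (1 + h a / 2)^2. *)
Lemma cabs_1Dh (l : R[i]) h : complex.Re l < 0 -> 0 <= h ->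
  h <= - complex.Re l / cabs l ^+ 2 ->
  cabs (1 + real_complex R h * l) <= 1 + h * (complex.Re l / 2).
Proof.
case: l => a b /= a0 h0.
have s0 : 0 < a ^+ 2 + b ^+ 2.
  by rewrite ltr_pwDl ?sqr_ge0// lt_def sqr_ge0 sqrf_eq0 lt_eqF.
rewrite sqr_sqrtr; last exact: ltW.
rewrite ler_pdivlMr// => hab.
(* Makes 1 + h a / 2 nonnegative, so that comparing squares suffices. *)
have ha : h * - a <= 1.
  have : h * - a * - a <= 1 * - a by nra.
  by rewrite ler_pM2r// oppr_gt0.
have ge0 : 0 <= 1 + h * (a / 2) by lra.
rewrite -[leRHS]ger0_norm// -sqrtr_sqr ler_wsqrtr//.
have : 0 <= (h * (a / 2)) ^+ 2 by exact: sqr_ge0.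
have : h * (h * (a ^+ 2 + b ^+ 2)) <= h * - a by rewrite ler_wpM2l.
nra.
Qed.

(** Schur triangularization, obtained from simultaneous triangularization of a one-element family.
    The diagonal entries of [T] are roots of its characteristic polynomial, hence eigenvalues of [A]
    by similarity. *)
Lemma hurwitz_triangular n (A : 'M[R]_n) : hurwitz A ->
  exists (P T : 'M[R[i]]_n), [/\ P \in unitmx, P *m complexmx A = T *m P,
    forall i j : 'I_n, (i < j)%N -> T i j = 0 & forall k, complex.Re (T k k) < 0].
Proof.
move=> hA; have [] := @cotrigonalization _ _ [:: complexmx A].
  by move=> ? ? /[!inE] /eqP -> /eqP ->.
move=> P /unitarymx_unit Pu /=; rewrite andbT /similar_to/= conjumx// => /is_trig_mxP Ttrig.
pose T := P *m complexmx A *m invmx P.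
have PA : P *m complexmx A = T *m P by rewrite /T mulmxKV.
exists P, T; split=> // k.
apply: hA; have : eigenvalue T (T k k).
  rewrite eigenvalue_root_char char_poly_trig; last by apply/is_trig_mxP.
  by rewrite rootE (bigD1 k)//= hornerM hornerXsubC subrr mul0r.
move=> /eigenvalueP[v vT v0]; apply/eigenvalueP; exists (v *m P).
  by rewrite -mulmxA PA mulmxA vT scalemxAl.
by apply: contra v0 => /eqP vP0; rewrite -[v](mulmxK Pu) vP0 mul0mx.
Qed.



Definition l1norm n (v : 'cV[R]_n) : R := \sum_i `|v i 0|.

Lemma l1norm_ge0 n (v : 'cV[R]_n) : 0 <= l1norm v.
Proof. by apply: sumr_ge0. Qed.

Lemma ler_l1norm n (v : 'cV[R]_n) i : `|v i 0| <= l1norm v.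
Proof. by rewrite /l1norm (bigD1 i)//= lerDl sumr_ge0. Qed.

(* In triangular coordinates z, the norm is sum_k e^k |z_k|: the weights make
   the off-diagonal part of A small when e is. *)
Lemma hurwitz_contraction_norm n (A : 'M[R]_n) : hurwitz A ->
  exists (nu : 'cV[R]_n -> R) (K c h0 : R), [/\ [/\ 0 < K, 0 < c & 0 < h0],
    forall v w, nu (v + w) <= nu v + nu w,
    forall v, nu v <= K * l1norm v, forall v, l1norm v <= K * nu v &
    forall h v, 0 <= h <= h0 -> nu (v + h *: (A *m v)) <= (1 - c * h) * nu v].
Proof.
move=> /hurwitz_triangular[P [T [Pu PA Ttrig Tneg]]].
(* A quarter of the slowest decay rate: by [cabs_1Dh] each diagonal factor is at most
   [1 - 2 * c * h], which leaves [c * h] to absorb the off-diagonal entries. *)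
have [c c0 cT] : exists2 c, 0 < c & forall k, c <= - complex.Re (T k k) / 4.
  by apply: finite_pos_lower_bound => k; have := Tneg k; lra.
have [h0 h00 h0T] : exists2 h0, 0 < h0 &
    forall k, h0 <= - complex.Re (T k k) / cabs (T k k) ^+ 2.
  apply: finite_pos_lower_bound => k; rewrite divr_gt0 ?oppr_gt0//.
  rewrite exprn_gt0// lt_def cabs_ge0 andbT; apply/eqP.
  move=> /complex.ComplexField.Normc.eq0_normc Tk0.
  by have := Tneg k; rewrite Tk0 /= ltxx.
pose tau := \sum_i \sum_j cabs (T i j).
have tau_ge0 : 0 <= tau by do 2 apply: sumr_ge0 => ? _; exact: cabs_ge0.
have tauP i j : cabs (T i j) <= tau.
  rewrite /tau (bigD1 i)//= (bigD1 j)//= -addrA lerDl addr_ge0 ?sumr_ge0// => *.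
    exact: cabs_ge0.
  by apply: sumr_ge0 => *; exact: cabs_ge0.
(* Chosen so that [e <= 1] and [e * (n%:R * tau) <= c]. *)
pose e : R := c / (c + n%:R * tau).
have den0 : 0 < c + n%:R * tau by rewrite ltr_pwDl// mulr_ge0.
have e0 : 0 < e by rewrite divr_gt0.
have e1 : e <= 1 by rewrite ler_pdivrMr// mul1r lerDl mulr_ge0.
have etau : e * (n%:R * tau) <= c.
  by rewrite mulrAC ler_pdivrMr// ler_wpM2l ?(ltW c0)// lerDr ltW.
pose z (v : 'cV[R]_n) := P *m complexmx v.
pose nu v := \sum_(k < n) e ^+ k * cabs (z v k 0).
have nu_ge0 v : 0 <= nu v.
  by apply: sumr_ge0 => k _; rewrite mulr_ge0 ?cabs_ge0// exprn_ge0 ?ltW.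
have nuz v (k : 'I_n) : e ^+ k * cabs (z v k 0) <= nu v.
  rewrite /nu (bigD1 k)//= lerDl sumr_ge0// => j _.
  by rewrite mulr_ge0 ?cabs_ge0// exprn_ge0 ?ltW.
pose K1 := \sum_i \sum_j cabs (P i j).
have K1_ge0 : 0 <= K1 by do 2 apply: sumr_ge0 => ? _; exact: cabs_ge0.
pose K2 := \sum_(i < n) \sum_(j < n) cabs (invmx P i j) / e ^+ j.
have K2_ge0 : 0 <= K2.
  do 2 apply: sumr_ge0 => ? _; rewrite divr_ge0 ?cabs_ge0// exprn_ge0 ?ltW//.
(* One constant serves both comparisons with [l1norm]: [K1] bounds [nu] from above, [K2] inverts the
   change of coordinates, and 1 ensures positivity. *)
exists nu, (1 + K1 + K2), c, h0; split.
- by split => //; rewrite -addrA ltr_pwDl// addr_ge0.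
- move=> v w; rewrite /nu -big_split ler_sum// => k _ /=.
  rewrite -mulrDr ler_wpM2l ?exprn_ge0 ?(ltW e0)//.
  have -> : z (v + w) = z v + z w by rewrite /z -mulmxDr -map_mxD.
  by rewrite [X in cabs X <= _]mxE cabsD.
- move=> v; apply: (@le_trans _ _ (K1 * l1norm v)).
    rewrite /nu /K1 mulr_suml ler_sum// => k _.
    rewrite mulr_suml (le_trans (ler_piMl _ _)) ?cabs_ge0 ?exprn_ile1 ?(ltW e0)//.
    rewrite mxE (le_trans (cabs_sum _ _ _))// ler_sum// => j _.
    rewrite cabsM ler_wpM2l ?cabs_ge0// mxE cabs_real.
    exact: ler_l1norm.
  by rewrite ler_wpM2r ?l1norm_ge0// -addrA addrCA lerDl addr_ge0.
- move=> v; apply: (@le_trans _ _ (K2 * nu v)).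
    rewrite /l1norm /K2 mulr_suml ler_sum// => i _.
    rewrite mulr_suml -cabs_real.
    have -> : real_complex R (v i 0) = (invmx P *m z v) i 0.
      by rewrite /z mulKmx// mxE.
    rewrite mxE (le_trans (cabs_sum _ _ _))// ler_sum// => j _.
    rewrite cabsM -mulrA ler_wpM2l ?cabs_ge0// mulrC ler_pdivlMr ?exprn_gt0//.
    by rewrite mulrC nuz.
  by rewrite ler_wpM2r// lerDr addr_ge0.
move=> h v /andP[h_ge0 hh0].
have zE (k : 'I_n) : z (v + h *: (A *m v)) k 0 =
    (1 + real_complex R h * T k k) * z v k 0 +
    real_complex R h * \sum_(j < n | (j < k)%N) T k j * z v j 0.
  have -> : z (v + h *: (A *m v)) = z v + real_complex R h *: (T *m z v).
    have e_ : complexmx (v + h *: (A *m v)) =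
        complexmx v + real_complex R h *: (complexmx A *m complexmx v).
      by rewrite /complexmx map_mxD map_mxZ map_mxM.
    by rewrite /z e_ mulmxDr -scalemxAr mulmxA -PA mulmxA.
  have TzE : (T *m z v) k 0 = T k k * z v k 0 + \sum_(j < n | (j < k)%N) T k j * z v j 0.
    rewrite mxE (bigID (fun j : 'I_n => (j < k)%N))/= addrC; congr (_ + _).
    rewrite (bigD1 k) ?ltnn//= big1 ?addr0// => j /andP[].
    rewrite -leqNgt leq_eqVlt => /orP[/eqP /val_inj ->|kj _]; first by rewrite eqxx.
    by rewrite Ttrig// mul0r.
  by rewrite [LHS]mxE [X in _ + X]mxE TzE; ring.
have step (k : 'I_n) : e ^+ k * cabs (z (v + h *: (A *m v)) k 0) <=
    (1 - 2 * c * h) * (e ^+ k * cabs (z v k 0)) + h * (e * tau * nu v).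
  rewrite zE (le_trans (ler_wpM2l _ (cabsD _ _))) ?exprn_ge0 ?(ltW e0)//.
  rewrite mulrDr !cabsM cabs_real ger0_norm// lerD//.
    rewrite mulrCA ler_wpM2r ?mulr_ge0 ?cabs_ge0 ?exprn_ge0 ?(ltW e0)//.
    have := cabs_1Dh (Tneg k) h_ge0 (le_trans hh0 (h0T k)).
    by have := cT k; nra.
  rewrite mulrCA ler_wpM2l//.
  rewrite (le_trans (ler_wpM2l _ (cabs_sum _ _ _))) ?exprn_ge0 ?(ltW e0)//.
  rewrite /nu mulr_sumr [leRHS]mulr_sumr [leLHS]big_mkcond/= ler_sum// => j _.
  have ez_ge0 : 0 <= e ^+ j * cabs (z v j 0).
    by rewrite mulr_ge0 ?cabs_ge0 ?exprn_ge0 ?(ltW e0).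
  case: ifPn => [jk|_]; last by rewrite mulr_ge0// mulr_ge0// ltW.
  (* Strict triangularity, [j < k], gains the factor [e] on every coupling term. *)
  have ek : e ^+ k <= e * e ^+ j.
    by rewrite -exprS ler_wiXn2l// ltW.
  have -> : e * tau * (e ^+ j * cabs (z v j 0)) = tau * (e * e ^+ j * cabs (z v j 0)).
    by ring.
  rewrite cabsM mulrCA ler_pM ?cabs_ge0 ?tauP ?ler_wpM2r ?cabs_ge0//.
  by rewrite mulr_ge0 ?cabs_ge0 ?exprn_ge0 ?(ltW e0).
apply: (@le_trans _ _ (\sum_(k < n)
  ((1 - 2 * c * h) * (e ^+ k * cabs (z v k 0)) + h * (e * tau * nu v)))).
  by apply: ler_sum => k _; exact: step.
rewrite big_split/= -mulr_sumr sumr_const card_ord -[X in _ + X]mulr_natl -/(nu v).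
have -> : (1 - c * h) * nu v = (1 - 2 * c * h) * nu v + h * (c * nu v) by ring.
have -> : n%:R * (h * (e * tau * nu v)) = h * (e * (n%:R * tau) * nu v) by ring.
by rewrite lerD2l ler_wpM2l// ler_wpM2r.
Qed.

End LyapunovNorm.

(** * Integral curves *)

Section IntegralCurves.
Local Open Scope classical_set_scope.
Context {R : realType}.
Notation mu := (@lebesgue_measure R).

(** Here [f] stands for the velocity and the curve starts at the origin. Integrability is included
    so that the integrals are additive and the increments can be estimated. *)
Definition integral_curve n (x f : R -> 'cV[R]_n) : Prop :=
  forall i t, 0 <= t ->
    mu.-integrable `[0, t] (EFin \o (fun s => f s i 0)) /\
    x t i 0 = \int[mu]_(s in `[0, t]) f s i 0.

Lemma integrable_sumr d (T : measurableType d) (nu : {measure set T -> \bar R})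
    (D : set T) (I : Type) (r : seq I) (f : I -> T -> R) : measurable D ->
  (forall i, nu.-integrable D (EFin \o f i)) ->
  nu.-integrable D (EFin \o (fun s => \sum_(i <- r) f i s)).
Proof.
move=> mD fi; rewrite (_ : _ \o _ = fun s => (\sum_(i <- r) (EFin \o f i) s)%E).
  by apply: integrable_sum.
by apply/funext => s /=; rewrite sumEFin.
Qed.

Lemma Rintegral_sumr d (T : measurableType d) (nu : {measure set T -> \bar R})
    (D : set T) (I : Type) (r : seq I) (f : I -> T -> R) : measurable D ->
  (forall i, nu.-integrable D (EFin \o f i)) ->
  \int[nu]_(s in D) (\sum_(i <- r) f i s) = \sum_(i <- r) \int[nu]_(s in D) f i s.
Proof.
move=> mD fi; elim: r => [|i r IH].
  under eq_Rintegral do rewrite big_nil.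
  by rewrite Rintegral_cst// mul0r big_nil.
under eq_Rintegral do rewrite big_cons.
by rewrite RintegralD// ?IH ?big_cons//; exact: integrable_sumr.
Qed.

Lemma integrable_scaler d (T : measurableType d) (nu : {measure set T -> \bar R})
    (D : set T) (a : R) (f : T -> R) : measurable D ->
  nu.-integrable D (EFin \o f) -> nu.-integrable D (EFin \o (fun s => a * f s)).
Proof.
move=> mD fi; rewrite (_ : _ \o _ = fun s => (a%:E * (EFin \o f) s)%E)//.
exact: integrableZl.
Qed.

Lemma integrable_cst_itv (c s t : R) : mu.-integrable `[s, t] (EFin \o (fun=> c)).
Proof.
apply: continuous_compact_integrable; first exact: segment_compact.
by apply: continuous_subspaceT => z; exact: cvg_cst.
Qed.

Lemma integral_curve_mulmx k n (L : 'M[R]_(k, n)) x f :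
  integral_curve x f -> integral_curve (fun t => L *m x t) (fun t => L *m f t).
Proof.
move=> xf i t t0.
have -> : (fun s => (L *m f s) i 0) = (fun s => \sum_j L i j * f s j 0).
  by apply/funext => s; rewrite mxE.
have fi j : mu.-integrable `[0, t] (EFin \o (fun s => L i j * f s j 0)).
  by apply: integrable_scaler => //; have [] := xf j t t0.
split; first exact: integrable_sumr.
rewrite Rintegral_sumr// mxE; apply: eq_bigr => j _.
by have [? ->] := xf j t t0; rewrite RintegralZl.
Qed.

(** Removing a uniform motion lets [l1norm_increment] measure the deviation from an Euler step. *)
Lemma integral_curve_drift n x f (v : 'cV[R]_n) :
  integral_curve x f -> integral_curve (fun t => x t - t *: v) (fun t => f t - v).
Proof.
move=> xf i t t0; have [fi xE] := xf i t t0.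
have ci := integrable_cst_itv (v i 0) 0 t.
have -> : (fun s => (f s - v) i 0) = (fun s => f s i 0 - v i 0).
  by apply/funext => s; rewrite !mxE.
split.
  rewrite (_ : _ \o _ = ((EFin \o (fun s => f s i 0)%R) \- (EFin \o (fun=> v i 0)%R))%E)//.
  exact: integrableB.
rewrite RintegralB// -xE Rintegral_cst//= lebesgue_measure_itv/=.
rewrite !mxE; case: ifPn => /= [_|]; first by rewrite subr0 mulrC.
by rewrite lte_fin -leNgt => t0'; rewrite (@le_anti _ _ t 0) ?t0 ?t0'// mul0r mulr0.
Qed.

Lemma integral_curve_increment n x f (F s t : R) (i : 'I_n) :
  integral_curve x f -> 0 <= s -> s <= t ->
  (forall r, s <= r -> r <= t -> `|f r i 0| <= F) ->
  `|x t i 0 - x s i 0| <= F * (t - s).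
Proof.
move=> xf s0 st fF.
have [fi ->] := xf i t (le_trans s0 st); have [_ ->] := xf i s s0.
rewrite (@Rintegral_itvB _ _ (BLeft 0) (BRight t) s)//.
have fsi : mu.-integrable `]s, t] (EFin \o (fun s => f s i 0)).
  by apply: integrableS fi => //; apply: subset_itv; rewrite bnd_simp.
apply: (le_trans (le_normr_Rintegral _ fsi)) => //.
have -> : F * (t - s) = \int[mu]_(r in `]s, t]) F.
  rewrite Rintegral_cst//= lebesgue_measure_itv/= lte_fin; case: ltP => //= ts.
  by rewrite (@le_anti _ _ t s) ?st ?ts// subrr.
apply: le_Rintegral => //=.
- exact: integrable_norm fsi.
- apply: integrableS (integrable_cst_itv F s t) => //; exact: subset_itv_oc_cc.
- by move=> r /=; rewrite in_itv/= => /andP[sr rt]; apply: fF => //; exact: ltW.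
Qed.

(** The factor [n%:R] arises because each coordinate of the velocity is bounded by its whole
    [l1norm]. *)
Lemma l1norm_increment n x f (F s t : R) :
  integral_curve x f -> 0 <= s -> s <= t ->
  (forall r, s <= r -> r <= t -> l1norm (f r : 'cV[R]_n) <= F) ->
  l1norm (x t - x s) <= n%:R * F * (t - s).
Proof.
move=> xf s0 st fF.
have -> : n%:R * F * (t - s) = \sum_(i < n) F * (t - s).
  by rewrite sumr_const card_ord -[RHS]mulr_natl mulrA.
apply: ler_sum => i _; rewrite !mxE; apply: (integral_curve_increment xf s0 st) => r sr rt.
by apply: le_trans (fF r sr rt); exact: ler_l1norm.
Qed.

Lemma l1normD n (v w : 'cV[R]_n) : l1norm (v + w) <= l1norm v + l1norm w.
Proof.
by rewrite /l1norm -big_split ler_sum// => i _; rewrite mxE ler_normD.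
Qed.

Definition mxabs k n (M : 'M[R]_(k, n)) : R := \sum_i \sum_j `|M i j|.

Lemma mxabs_ge0 k n (M : 'M[R]_(k, n)) : 0 <= mxabs M.
Proof. by do 2 apply: sumr_ge0 => ? _. Qed.

Lemma l1norm_mulmx k n (M : 'M[R]_(k, n)) v : l1norm (M *m v) <= mxabs M * l1norm v.
Proof.
rewrite /l1norm /mxabs mulr_suml ler_sum// => i _.
rewrite mulr_suml mxE (le_trans (ler_norm_sum _ _ _))// ler_sum// => j _.
by rewrite normrM ler_wpM2l// ler_l1norm.
Qed.

End IntegralCurves.

(** * Decay of the state along a sequence of times *)

Section Decay.
Local Open Scope classical_set_scope.
Context {R : realType}.

Lemma perturbed_contraction_small (a : nat -> R) (rho : R) :
  0 <= rho < 1 -> (forall k, 0 <= a k) ->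
  (forall e, 0 < e -> exists k0, forall k, (k0 <= k)%N -> a k.+1 <= rho * a k + e) ->
  forall eta k1, 0 < eta -> exists2 k, (k1 <= k)%N & a k <= eta.
Proof.
move=> /andP[rho0 rho1] a0 ha eta k1 eta0.
(* With this perturbation [eta / 2] is the fixed point of the affine recursion, and the excess over
   it decays like [rho ^+ m]. *)
have [k0 hk0] : exists k0, forall k, (k0 <= k)%N ->
    a k.+1 <= rho * a k + (1 - rho) * (eta / 2).
  by apply: ha; rewrite mulr_gt0 ?subr_gt0// divr_gt0.
pose k2 := maxn k0 k1.
have ak m : a (k2 + m)%N <= rho ^+ m * a k2 + eta / 2.
  elim: m => [|m IH]; first by rewrite addn0 expr0 mul1r lerDl divr_ge0// ltW.
  rewrite addnS; apply: le_trans (hk0 _ _) _.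
    by rewrite (leq_trans (leq_maxl k0 k1))// leq_addr.
  by rewrite exprS; have := ler_wpM2l rho0 IH; lra.
have : rho ^+ m @[m --> \oo] --> (0 : R) by apply: cvg_expr; rewrite ger0_norm.
move=> /cvgrPdist_le /(_ (eta / 2 / (a k2 + 1))) [].
  by rewrite !divr_gt0// ltr_wpDl.
move=> m _ /(_ m (leqnn m)); rewrite sub0r normrN ger0_norm ?exprn_ge0// => hm.
exists (k2 + m)%N; first by rewrite (leq_trans (leq_maxr k0 k1))// leq_addr.
apply: le_trans (ak m) _.
suff : rho ^+ m * a k2 <= eta / 2 by lra.
apply: le_trans (_ : rho ^+ m * (a k2 + 1) <= _).
  by rewrite ler_wpM2l ?exprn_ge0// lerDl.
by rewrite -ler_pdivlMr// ltr_wpDl.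
Qed.

Lemma continuous_sumr (T : topologicalType) (I : Type) (r : seq I) (f : I -> T -> R) :
  (forall i, continuous (f i)) -> continuous (fun t => \sum_(i <- r) f i t).
Proof. by move=> fc; apply: continuous_big => //; exact: add_continuous. Qed.

Variables (n m : nat) (A : 'M[R]_n) (B : 'M[R]_(n, m)).
Variables (x : R -> 'cV[R]_n) (u : R -> 'cV[R]_m).
Hypothesis xu : integral_curve x (fun t => A *m x t + B *m u t).
Hypothesis xcont : forall i, continuous (fun t => x t i 0).

Lemma continuous_l1norm : continuous (fun t => l1norm (x t)).
Proof. by apply: continuous_sumr => i t; apply: cvg_norm; exact: xcont. Qed.

(** Let M be the maximum of |x| over the step. Smallness of q = n |A| h absorbs M / 2, which bounds
    M by the initial state and the input. After removal of the drift A x(t) the velocity is A (x(s)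
    - x(t)) + B u(s), which makes the state term of second order in h. *)
Lemma euler_step_error (t h e : R) : 0 <= t -> 0 <= h ->
  n%:R * mxabs A * h <= 1 / 2 ->
  (forall s, t <= s -> s <= t + h -> l1norm (u s) <= e) ->
  l1norm (x (t + h) - (x t + h *: (A *m x t))) <=
  2 * (n%:R * mxabs A * h) ^+ 2 * l1norm (x t) + 2 * n%:R * h * mxabs B * e.
Proof.
move=> t0 h0; set a := mxabs A; set b := mxabs B => small ue.
have a0 : 0 <= a by exact: mxabs_ge0.
have b0 : 0 <= b by exact: mxabs_ge0.
have tth : t <= t + h by rewrite lerDl.
have [s0 s0t M_max] := EVT_max tth (continuous_subspaceT continuous_l1norm).
set M := l1norm (x s0) in M_max.
have M0 : 0 <= M by exact: l1norm_ge0.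
have e0 : 0 <= e by apply: le_trans (ue t _ _) => //; exact: l1norm_ge0.
have Bu s : t <= s -> s <= t + h -> l1norm (B *m u s) <= b * e.
  move=> ts sth; apply: (le_trans (l1norm_mulmx _ _)).
  by rewrite ler_wpM2l// ue.
have dx s : t <= s -> s <= t + h -> l1norm (x s - x t) <= n%:R * h * (a * M + b * e).
  move=> ts sth; apply: (le_trans (l1norm_increment (F := a * M + b * e) xu t0 ts _)).
    move=> r tr rs; apply: (le_trans (l1normD _ _)).
    rewrite lerD ?Bu ?(le_trans rs)// (le_trans (l1norm_mulmx _ _))// ler_wpM2l// M_max//.
    by rewrite in_itv/= tr (le_trans rs).
  rewrite mulrAC ler_wpM2r ?addr_ge0 ?mulr_ge0// ler_wpM2l//; lra.
(* The part of the increment at [s0] that is proportional to [M] is at most [M / 2] by [small], and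
   moves to the left-hand side. *)
have hM : M <= 2 * l1norm (x t) + 2 * n%:R * h * b * e.
  move: s0t; rewrite in_itv/= => /andP[ts0 s0th].
  have : M <= l1norm (x s0 - x t) + l1norm (x t).
    by rewrite /M -{1}[x s0](subrK (x t)) l1normD.
  have := dx _ ts0 s0th.
  have : n%:R * a * h * M <= 1 / 2 * M by rewrite ler_wpM2r.
  nra.
have yu := integral_curve_drift (A *m x t) xu.
have -> : x (t + h) - (x t + h *: (A *m x t)) =
    (x (t + h) - (t + h) *: (A *m x t)) - (x t - t *: (A *m x t)).
  by apply/matrixP => i j; rewrite !mxE; ring.
pose F := a * (n%:R * h * (a * M + b * e)) + b * e.
apply: (le_trans (l1norm_increment (F := F) yu t0 tth _)).
  move=> r tr rth; rewrite addrAC -mulmxBr.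
  apply: (le_trans (l1normD _ _)); rewrite lerD ?Bu//.
  by rewrite (le_trans (l1norm_mulmx _ _))// ler_wpM2l// dx.
rewrite addrAC subrr add0r /F; set q := n%:R * a * h in small *.
have q0 : 0 <= q by rewrite !mulr_ge0.
have -> : n%:R * (a * (n%:R * h * (a * M + b * e)) + b * e) * h =
  q ^+ 2 * M + (q + 1) * (n%:R * h * b * e) by rewrite /q; ring.
have w0 : 0 <= n%:R * h * b * e by rewrite !mulr_ge0.
have : q ^+ 2 * M <= q ^+ 2 * (2 * l1norm (x t) + 2 * n%:R * h * b * e).
  by rewrite ler_wpM2l ?sqr_ge0.
have : (q + 1) * (n%:R * h * b * e) <= 3 / 2 * (n%:R * h * b * e).
  by rewrite ler_wpM2r//; lra.
have : 2 * q ^+ 2 * (n%:R * h * b * e) <= 1 / 2 * (n%:R * h * b * e).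
  by rewrite ler_wpM2r//; nra.
nra.
Qed.

Hypothesis hA : hurwitz A.
Hypothesis u0 : forall e, 0 < e -> exists T0, forall t, T0 <= t -> l1norm (u t) <= e.

Lemma hurwitz_state_small eta T0 : 0 < eta -> exists2 T, T0 <= T & l1norm (x T) <= eta.
Proof.
move=> eta0.
have [nu [K [c [h0 [[K0 c0 h00] nuD nuK Knu nuA]]]]] := hurwitz_contraction_norm hA.
pose a := mxabs A; have a0 : 0 <= a by exact: mxabs_ge0.
pose b := mxabs B; have b0 : 0 <= b by exact: mxabs_ge0.
(* Coefficient of h^2 in the Euler error measured in [nu]; one [K] converts from [l1norm] and the
   other back to it. *)
pose kappa := 2 * (n%:R * a) ^+ 2 * K * K.
have kappa0 : 0 <= kappa by rewrite !mulr_ge0 ?sqr_ge0 ?(ltW K0).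
have na0 : 0 <= 2 * n%:R * a by rewrite !mulr_ge0.
have kc0 : 0 <= 2 * kappa / c by rewrite divr_ge0 ?mulr_ge0// ltW.
(* The three summands yield [hna], [hka] and [hc] once [h * D <= 1]; the definition of [h] ensures
   this together with [h <= h0]. *)
pose D := 2 * n%:R * a + 2 * kappa / c + c.
have D0 : 0 < D by rewrite ltr_wpDl// addr_ge0.
pose h := h0 / (1 + h0 * D).
have den0 : 0 < 1 + h0 * D by rewrite ltr_wpDl// mulr_gt0.
have hgt0 : 0 < h by rewrite divr_gt0.
have hh0 : h <= h0 by rewrite ler_pdivrMr// ler_pMr// lerDl mulr_ge0// ltW.
have hD : h * D <= 1 by rewrite mulrAC ler_pdivrMr// mul1r lerDr.
have hna : n%:R * a * h <= 1 / 2.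
  have : 0 <= h * (2 * kappa / c + c) by rewrite mulr_ge0 ?addr_ge0// ltW.
  by move: hD; rewrite /D; nra.
have hka : kappa * h <= c / 2.
  have : h * (2 * kappa / c) <= 1.
    apply: le_trans hD; rewrite ler_wpM2l ?(ltW hgt0)// /D.
    by rewrite [leRHS]addrAC lerDr addr_ge0// ltW.
  by rewrite mulrA ler_pdivrMr// mul1r; lra.
have hc : c * h <= 1.
  apply: le_trans hD; rewrite mulrC ler_wpM2l ?(ltW hgt0)// /D.
  by rewrite lerDr addr_ge0.
have nu0 v : 0 <= nu v.
  by rewrite -(pmulr_rge0 _ K0) (le_trans _ (Knu v))// l1norm_ge0.
(* The Euler error costs at most half of the contraction, so the rate [1 - c * h] becomes
   [1 - c * h / 2]. *)
have step (t e : R) : 0 <= t -> (forall s, t <= s -> l1norm (u s) <= e) ->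
    nu (x (t + h)) <= (1 - c * h / 2) * nu (x t) + K * (2 * n%:R * h * b) * e.
  move=> t0 ue.
  have err := euler_step_error t0 (ltW hgt0) hna (fun s ts _ => ue s ts).
  set z := x t + h *: (A *m x t) in err.
  have := nuD z (x (t + h) - z); rewrite addrC subrK => le1.
  have le2 : nu z <= (1 - c * h) * nu (x t) by apply: nuA; rewrite (ltW hgt0).
  have le3 := le_trans (nuK _) (ler_wpM2l (ltW K0) err).
  have le4 : K * (2 * (n%:R * a * h) ^+ 2 * l1norm (x t)) <= (c * h / 2) * nu (x t).
    apply: (@le_trans _ _ (kappa * h * h * nu (x t))).
      have -> : kappa * h * h * nu (x t) =
        K * (2 * (n%:R * a * h) ^+ 2) * (K * nu (x t)) by rewrite /kappa; ring.
      by rewrite mulrA ler_wpM2l// mulr_ge0 ?(ltW K0)// mulr_ge0// sqr_ge0.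
    rewrite ler_wpM2r//; have := ler_wpM2r (ltW hgt0) hka; lra.
  by move: le1 le2 le3 le4; rewrite -/a -/b; lra.
pose ak k := nu (x (k%:R * h)).
have bound_le (T : R) (k : nat) : (Num.bound (`|T| / h) <= k)%N -> T <= k%:R * h.
  move=> kb; rewrite -ler_pdivrMr//; apply: le_trans (_ : `|T| / h <= _).
    by rewrite ler_wpM2r ?ler_norm// invr_ge0 ltW.
  apply: le_trans (_ : (Num.bound (`|T| / h))%:R <= _); last by rewrite ler_nat.
  by apply/ltW/archi_boundP; rewrite divr_ge0// ltW.
have rho_itv : 0 <= 1 - c * h / 2 < 1 by have := mulr_gt0 c0 hgt0; lra.
have ak_step e : 0 < e -> exists k0, forall k, (k0 <= k)%N ->
    ak k.+1 <= (1 - c * h / 2) * ak k + e.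
  move=> e0; pose K' := K * (2 * n%:R * h * b).
  have K'0 : 0 <= K'.
    apply: mulr_ge0; first exact: ltW.
    apply: mulr_ge0 => //; apply: mulr_ge0; last exact: ltW.
    exact: mulr_ge0.
  have [T1 hT1] : exists T1, forall t, T1 <= t -> l1norm (u t) <= e / (K' + 1).
    by apply: u0; rewrite divr_gt0// ltr_wpDl.
  exists (Num.bound (`|T1| / h)) => k kb.
  have T1k := bound_le T1 k kb.
  have kh0 : 0 <= k%:R * h by rewrite mulr_ge0// ltW.
  have := step _ _ kh0 (fun s ks => hT1 s (le_trans T1k ks)).
  have -> : k%:R * h + h = k.+1%:R * h by rewrite -natr1 mulrDl mul1r.
  move=> /le_trans; apply; rewrite -/K' -/(ak k).
  by rewrite lerD2l mulrCA ler_piMr ?(ltW e0)// ler_pdivrMr ?mul1r ?lerDl// ltr_wpDl.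
have [k k1k akk] := perturbed_contraction_small rho_itv (fun k => nu0 _) ak_step
  (Num.bound (`|T0| / h)) (divr_gt0 eta0 K0).
exists (k%:R * h); first exact: bound_le.
by apply: (le_trans (Knu _)); rewrite mulrC -ler_pdivlMr.
Qed.

End Decay.

(** * The storage function along a trajectory *)

Section Storage.
Local Open Scope classical_set_scope.
Context {R : realType}.
Notation mu := (@lebesgue_measure R).

Section Continuity.
Variables (n : nat) (x : R -> 'cV[R]_n).
Hypothesis xcont : forall i, continuous (fun t => x t i 0).

Lemma continuous_mulmx k (L : 'M[R]_(k, n)) i : continuous (fun t => (L *m x t) i 0).
Proof.
under eq_fun do rewrite mxE.
by apply: continuous_sumr => j t; apply: cvgM; [exact: cvg_cst|exact: xcont].
Qed.

Lemma continuous_qform (M : 'M[R]_n) : continuous (fun t => qform M (x t)).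
Proof.
have -> : (fun t => qform M (x t)) = fun t => \sum_j x t j 0 * (M *m x t) j 0.
  by apply/funext => t; rewrite /qform -mulmxA mxE; apply: eq_bigr => j _; rewrite mxE.
by apply: continuous_sumr => j t; apply: cvgM; [exact: xcont|exact: continuous_mulmx].
Qed.

End Continuity.

Lemma continuous_integrable (f : R -> R) (s t : R) : continuous f ->
  mu.-integrable `[s, t] (EFin \o f).
Proof.
move=> fc; apply: continuous_compact_integrable; first exact: segment_compact.
exact: continuous_subspaceT.
Qed.

Lemma is_derive_primitive (f : R -> R) (t : R) : continuous f -> 0 < t ->
  is_derive t 1 (fun s => \int[mu]_(r in `[0, s]) f r) (f t).
Proof.
move=> fc t0.
have tt1 : t < t + 1 by rewrite ltrDl.
have [dF F'] := continuous_FTC1_closed tt1 (continuous_integrable 0 (t + 1) fc) t0 (fc t).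
by apply: DeriveDef => //; rewrite -F' derive1E.
Qed.

Variables (n m : nat) (A : 'M[R]_n) (B : 'M[R]_(n, m)).
Variables (x : R -> 'cV[R]_n) (u : R -> 'cV[R]_m).
Hypothesis xu : integral_curve x (fun t => A *m x t + B *m u t).
Hypothesis xcont : forall i, continuous (fun t => x t i 0).

(* For a generalized inverse G of P, x^T P x = (P x)^T G (P x) is a product of
   primitives of continuous functions. *)
Lemma storage_identity (P : 'M[R]_n) (T : R) : P^T = P -> P *m B = 0 -> 0 < T ->
  qform P (x T) = \int[mu]_(s in `[0, T]) qform (A^T *m P + P *m A) (x s).
Proof.
move=> PT PB T0.
have smooth (L : 'M[R]_n) i (t : R) : 0 <= t ->
    (L *m P *m x t) i 0 = \int[mu]_(s in `[0, t]) (L *m P *m A *m x s) i 0.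
  move=> t0; have [_ ->] := integral_curve_mulmx (L *m P) xu i t0.
  apply: eq_Rintegral => s _.
  by rewrite mulmxDr !mulmxA -(mulmxA L P B) PB mulmx0 mul0mx addr0.
(* [P] may be singular, so its pseudo-inverse replaces the inverse. *)
have [G PGP] : exists G, P *m G *m P = P by exists (pinvmx P); rewrite mulmxKpV.
pose prim (L : 'M[R]_n) i t := \int[mu]_(s in `[0, t]) (L *m P *m A *m x s) i 0.
pose W t := \sum_(i < n) prim 1%:M i t * prim G i t.
have WE (t : R) : 0 <= t -> W t = qform P (x t).
  move=> t0; rewrite /W; under eq_bigr do rewrite /prim -!smooth//.
  rewrite /qform -[in RHS]PGP -!mulmxA.
  have -> : (x t)^T *m (P *m (G *m (P *m x t))) = (P *m x t)^T *m (G *m (P *m x t)).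
    by rewrite trmx_mul PT mulmxA.
  by rewrite [RHS]mxE; apply: eq_bigr => i _; rewrite mul1mx [X in _ = X * _]mxE.
have dW (t : R) : 0 < t -> is_derive t 1 W (qform (A^T *m P + P *m A) (x t)).
  move=> t0.
  have dprim L i : is_derive t 1 (prim L i) ((L *m P *m A *m x t) i 0).
    by apply: is_derive_primitive => //; exact: continuous_mulmx.
  (* By [PGP], the two terms of the product rule are x^T P A x and x^T A^T P x. *)
  have -> : qform (A^T *m P + P *m A) (x t) = \sum_(i < n)
      (prim 1%:M i t *: ((G *m P *m A *m x t) i 0) +
       prim G i t *: ((1%:M *m P *m A *m x t) i 0)).
    rewrite qformD addrC big_split/=; congr (_ + _).
      rewrite /qform -[in LHS]PGP.
      have -> : (x t)^T *m (P *m G *m P *m A) *m x t = (P *m x t)^T *m (G *m P *m A *m x t).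
        by rewrite trmx_mul PT !mulmxA.
      rewrite mxE; apply: eq_bigr => i _.
      by rewrite mxE /prim -smooth ?mul1mx// ltW.
    rewrite /qform -[in LHS]PGP.
    have -> : (x t)^T *m (A^T *m (P *m G *m P)) *m x t = (P *m A *m x t)^T *m (G *m P *m x t).
      by rewrite !trmx_mul PT !mulmxA.
    rewrite mxE; apply: eq_bigr => i _.
    by rewrite mxE /prim -smooth ?mul1mx ?(ltW t0)// mulrC.
  have -> : W = \sum_(i < n) (prim 1%:M i * prim G i).
    by apply/funext => s; rewrite fct_sumE.
  by apply: is_derive_sum => i; exact: is_deriveM.
have x0 : x 0 = 0.
  apply/matrixP => i j; rewrite ord1 mxE; have [_ ->] := xu i (lexx 0).
  by rewrite set_itv1 Rintegral_set1.
have Vcont M : continuous (fun t => qform M (x t)) by exact: continuous_qform.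
(* The derivative of [W] is known at positive times only; at 0, right continuity comes from
   [qform P (x t)], with which [W] agrees on the half-line. *)
have W0 : W s @[s --> 0^'+] --> W 0.
  rewrite WE//; apply: cvg_trans (cvg_at_right_filter (Vcont P 0)).
  apply: near_eq_cvg; near=> s.
  have s0 : 0 < s by near: s; exact: nbhs_right_gt.
  by rewrite WE// ltW.
have WT : W s @[s --> T^'-] --> W T.
  apply: cvg_at_left_filter; apply: differentiable_continuous.
  by apply/derivable1_diffP; have [] := dW T T0.
have := @continuous_FTC2 _ (fun s => qform (A^T *m P + P *m A) (x s)) W 0 T T0 _ _ _.
have q0 : qform P (x 0) = 0 by rewrite x0 /qform mulmx0 mxE.
rewrite !WE ?(ltW T0)// q0 sube0 /Rintegral => -> //.
- exact/continuous_subspaceT/Vcont.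
- split => // s; rewrite in_itv/= => /andP[s0 _].
  by have [] := dW s s0.
- move=> s; rewrite in_itv/= => /andP[s0 _].
  by have [_] := dW s s0; rewrite derive1E.
Unshelve. all: by end_near. Qed.

End Storage.

(** * Signals, trajectories and integrals over the half-line *)

Section SignalFacts.
Local Open Scope classical_set_scope.
Context {R : realType}.
Notation mu := (@lebesgue_measure R).

(** On a bounded interval [1 + g] is integrable, and it dominates because |r| <= 1 + r^2. *)
Lemma square_integrable_integrable m (u : R -> 'cV[R]_m) i (t : R) :
  square_integrable u -> mu.-integrable `[0, t] (EFin \o (fun s => u s i 0)).
Proof.
move=> [mu_u fin_u].
have sub : `[0, t]%classic `<=` (`[0, +oo[%classic : set R).
  by apply: subset_itvl.
have mut j : measurable_fun `[0, t] (fun s => u s j 0).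
  exact: measurable_funS (mu_u j).
pose g s : R := ((u s)^T *m u s) 0 0.
have gE s : g s = \sum_j u s j 0 ^+ 2.
  by rewrite /g mxE; apply: eq_bigr => j _; rewrite mxE expr2.
have g0 s : 0 <= g s by rewrite gE sumr_ge0// => j _; exact: sqr_ge0.
have gi : mu.-integrable `[0, +oo[ (EFin \o g).
  apply/integrableP; split.
    apply/measurable_EFinP; rewrite (funext gE).
    by apply: measurable_sum => j; apply: measurable_funX; exact: mu_u.
  by under eq_integral do rewrite /= ger0_norm//.
apply: (@le_integrable _ _ _ mu _ _ _ (EFin \o (fun s => 1 + g s))) => //.
- by apply/measurable_EFinP; exact: mut.
- move=> s _ /=; rewrite lee_fin [leRHS]ger0_norm ?addr_ge0//.
  apply: (@le_trans _ _ (1 + u s i 0 ^+ 2)).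
    rewrite -[X in _ <= _ + X]real_normK ?num_real//.
    by have := sqr_ge0 (`|u s i 0| - 1 / 2); nra.
  by rewrite lerD2l gE (bigD1 i)//= lerDl sumr_ge0// => j _; exact: sqr_ge0.
rewrite (_ : _ \o _ = ((EFin \o (fun=> 1%R)) \+ (EFin \o g))%E)//.
apply: integrableD => //; first exact: integrable_cst_itv.
exact: integrableS gi.
Qed.

(* A trajectory is only continuous within [0, +oo[; t |-> x (max t 0) is
   continuous on R. *)
Lemma continuous_clamp n (x : R -> 'cV[R]_n) i :
  {within `[0, +oo[, continuous x} -> continuous (fun t : R => x (Num.max t 0) i 0).
Proof.
move=> /subspace_continuousP xc t.
apply: (@cvg_comp _ _ _ (fun s : R => x (Num.max s 0)) (fun M : 'cV[R]_n => M i 0) _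
  (nbhs (x (Num.max t 0)))); last exact: coord_continuous.
have clamp_ge0 (s : R) : `[0, +oo[%classic (Num.max s 0).
  by rewrite /= in_itv/= le_max lexx orbT.
apply: cvg_comp (xc _ (clamp_ge0 t)).
have mc : Num.max s 0 @[s --> t] --> Num.max t 0.
  by apply: continuous_max; [exact: cvg_id|exact: cvg_cst].
move=> P /mc hP.
have {}hP : \forall s \near t, `[0, +oo[%classic (Num.max s 0) -> P (Num.max s 0).
  exact: hP.
change (\forall s \near t, P (Num.max s 0)).
by apply: filterS hP => s; apply; exact: clamp_ge0.
Qed.

(** Clamping changes [x] at negative times only. The integrability required of the velocity comes
    from continuity of the state and local integrability of the input. *)
Lemma trajectory_integral_curve n m (A : 'M[R]_n) (B : 'M[R]_(n, m)) u x :
  square_integrable u -> trajectory A B 0 u x ->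
  let y (t : R) := x (Num.max t 0) in
  (forall i, continuous (fun t => y t i 0)) /\
  integral_curve y (fun t => A *m y t + B *m u t).
Proof.
move=> su [xc xE] y; have yc i : continuous (fun t => y t i 0) by exact: continuous_clamp.
split=> // i t t0.
have yx s : 0 <= s -> y s = x s by move=> s0; rewrite /y max_l.
split.
  rewrite (_ : _ \o _ = ((EFin \o (fun s => (A *m y s) i 0)%R) \+
      (EFin \o (fun s => \sum_j B i j * u s j 0)%R))%E); last first.
    by apply/funext => s /=; rewrite !mxE.
  apply: integrableD => //; first exact/continuous_integrable/continuous_mulmx.
  apply: integrable_sumr => // j; apply: integrable_scaler => //.
  exact: square_integrable_integrable.
rewrite yx// xE// mxE add0r; apply: eq_Rintegral => s.
by rewrite inE/= in_itv/= => /andP[s0 _]; rewrite yx.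
Qed.

Lemma vanishing_l1norm m (u : R -> 'cV[R]_m) :
  u t @[t --> +oo] --> (0 : 'cV[R]_m) ->
  forall e, 0 < e -> exists T0, forall t, T0 <= t -> l1norm (u t) <= e.
Proof.
move=> u0 e e0.
have : l1norm (u t) @[t --> +oo] --> (0 : R).
  have -> : 0 = \sum_(i < m) `|(0 : 'cV[R]_m) i 0|
    by rewrite big1// => i _; rewrite mxE normr0.
  apply: cvg_big => //; first exact: add_continuous.
  move=> i _; apply: cvg_norm.
  apply: (@cvg_comp _ _ _ u (fun M : 'cV[R]_m => M i 0) _ (nbhs (0 : 'cV[R]_m))) => //.
  exact: coord_continuous.
(* Neighbourhoods of infinity contain strict half-lines, hence [T0 + 1]. *)
move=> /cvgrPdist_le /(_ e e0) [T0 [_ hT]]; exists (T0 + 1) => t tT.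
have := hT t; rewrite sub0r normrN ger0_norm ?l1norm_ge0//; apply.
by apply: lt_le_trans tT; rewrite ltrDl.
Qed.

Lemma qform_le_l1norm n (P : 'M[R]_n) v :
  `|qform P v| <= mxabs P * l1norm v ^+ 2.
Proof.
rewrite /qform -mulmxA mxE; apply: le_trans (ler_norm_sum _ _ _) _.
rewrite expr2 mulrA /l1norm mulr_sumr ler_sum// => i _.
rewrite normrM mxE mulrC ler_wpM2r//.
by apply: le_trans (l1norm_mulmx P v); exact: ler_l1norm.
Qed.

Lemma measurable_EFin_continuous (f : R -> R) (D : set R) :
  measurable D -> continuous f -> measurable_fun D (EFin \o f).
Proof.
move=> mD fc; apply/measurable_EFinP; apply: measurable_funTS.
exact: continuous_measurable_fun.
Qed.

Lemma integral_le_halfline (f : R -> R) (c T : R) : continuous f ->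
  (forall t, 0 <= f t) -> (\int[mu]_(t in `[0%R, +oo[) (f t)%:E <= c%:E)%E ->
  \int[mu]_(t in `[0, T]) f t <= c.
Proof.
move=> fc f0 fle; rewrite -lee_fin; apply: le_trans fle.
rewrite /Rintegral fineK; last first.
  by apply: integrable_fin_num => //; exact: continuous_integrable.
apply: ge0_subset_integral => //.
- by apply: measurable_EFin_continuous fc; exact: measurable_itv.
- by move=> t _; rewrite lee_fin.
- exact: subset_itvl.
Qed.

(** Monotone convergence along the intervals [0, k]. The bound is asked only for some arbitrarily
    late [T], matching [hurwitz_state_small]; each [0, k] lies in such a [0, T]. *)
Lemma integral_halfline_le (f : R -> R) (c : R) : continuous f ->
  (forall t, 0 <= f t) ->
  (forall e T0, 0 < e -> exists2 T, T0 <= T & \int[mu]_(t in `[0, T]) f t <= c + e) ->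
  (\int[mu]_(t in `[0%R, +oo[) (f t)%:E <= c%:E)%E.
Proof.
move=> fc f0 h.
have intE (T : R) : (\int[mu]_(t in `[0%R, T]) (f t)%:E)%E =
    (\int[mu]_(t in `[0, T]) f t)%:E.
  rewrite /Rintegral fineK//; apply: integrable_fin_num => //.
  exact: continuous_integrable.
have cupE : `[0, +oo[%classic = \bigcup_k (`[0, k%:R]%classic : set R).
  apply/seteqP; split => [t|t [k _]]/=; rewrite !in_itv/= andbT; last by case/andP.
  move=> t0; exists (Num.bound t) => //=; rewrite in_itv/= t0/= ltW//.
  exact: archi_boundP.
pose I (k : nat) : set R := `[0, k%:R]%classic.
have cv : (\int[mu]_(t in I k) (f t)%:E)%E @[k --> \oo] -->
    (\int[mu]_(t in \bigcup_k I k) (f t)%:E)%E.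
  apply: ge0_nondecreasing_set_cvg_integral => [k l kl|k|k|k t _].
  - by rewrite subsetEset; apply: subset_itvl; rewrite bnd_simp ler_nat.
  - by rewrite /I.
  - by apply: measurable_EFin_continuous; rewrite /I.
  - by rewrite lee_fin.
rewrite cupE; apply: (cvge_to_le cv).
near=> k; apply/lee_addgt0Pr => e e0.
have [T kT le] := h e k%:R e0.
apply: (@le_trans _ _ (\int[mu]_(t in `[0%R, T]) (f t)%:E)%E).
  rewrite /I; apply: ge0_subset_integral => //.
  - by apply: measurable_EFin_continuous fc; exact: measurable_itv.
  - by move=> t _; rewrite lee_fin.
  - by apply: subset_itvl; rewrite bnd_simp.
by rewrite intE -EFinD lee_fin.
Unshelve. all: by end_near. Qed.

End SignalFacts.

(** * Weak duality *)

Section WeakDuality.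
Local Open Scope classical_set_scope.
Context {R : realType} {N n m : nat} {p : 'I_N -> nat}.
Notation mu := (@lebesgue_measure R).

Variables (PP MM : {set 'I_N}).
Variables (A : 'M[R]_n) (B : 'M[R]_(n, m)) (C : forall i, 'M[R]_(p i, n)).
Variables (Q S : forall i, 'M[R]_(p i)) (delta : 'I_N -> R).
Hypothesis hA : hurwitz A.
Hypothesis hQ : forall i, i \in PP -> psdmx (Q i).
Hypothesis hS : forall j, j \in MM -> psdmx (S j).

Lemma quad_energy_clamp k (W : 'M[R]_k) (L : 'M[R]_(k, n)) (x : R -> 'cV[R]_n) :
  quad_energy W (fun t => L *m x t) =
  (\int[mu]_(t in `[0%R, +oo[) (qform (L^T *m W *m L) (x (Num.max t 0)))%:E)%E.
Proof.
apply: eq_integral => t; rewrite inE/= in_itv/= andbT => t0.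
by rewrite qform_mulmx max_l.
Qed.

(** Integrated along the trajectory, the matrix inequality bounds the performance energy up to [T]
    by the weighted measured energies minus the storage at [T], which is negligible for suitable
    late [T]. *)
Lemma weak_duality u x (gamma : 'cV[R]_#|MM|) (P : 'M[R]_n) :
  op_feasible MM A B C S delta u x -> sdp_feasible PP A B C Q S gamma P ->
  (op_objective PP C Q x <= (sdp_objective delta gamma)%:E)%E.
Proof.
move=> [[su u0] tr meas] [PT nsd gamma0].
have [PB K] : P *m B = 0 /\
    forall v, qform (A^T *m P + P *m A + sdp_Gamma PP C Q S gamma) v <= 0.
  by apply: nsd_block0; rewrite trmx_mul PT.
have [yc yu] := trajectory_integral_curve su tr.
set y := (fun t : R => x (Num.max t 0)) in yc yu.
have qc M : continuous (fun t => qform M (y t)) by exact: continuous_qform.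
have qi M T : mu.-integrable `[0, T] (EFin \o (fun t => qform M (y t))).
  exact/continuous_integrable.
pose Sm (k : 'I_#|MM|) := (C (enum_val k))^T *m S (enum_val k) *m C (enum_val k).
pose Mp := #|PP|%:R^-1 *: (\sum_(i in PP) (C i)^T *m Q i *m C i).
have Mp_ge0 v : 0 <= qform Mp v.
  rewrite qformZ qform_sum mulr_ge0 ?invr_ge0// sumr_ge0// => i iP.
  exact/psd_qform_ge0/hQ.
have Sm_le k T : \int[mu]_(t in `[0, T]) qform (Sm k) (y t) <= delta (enum_val k).
  apply: integral_le_halfline => //; first by move=> t; exact/psd_qform_ge0/hS/enum_valP.
  by rewrite -(quad_energy_clamp _ _ x); exact/meas/enum_valP.
have objE : op_objective PP C Q x = (\int[mu]_(t in `[0%R, +oo[) (qform Mp (y t))%:E)%E.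
  rewrite /op_objective; under eq_bigr do rewrite quad_energy_clamp.
  (* Extension by 0 outside [PP] makes every summand nonnegative, as the exchange of sum and
     integral requires. *)
  pose h i t := if i \in PP then qform ((C i)^T *m Q i *m C i) (y t) else 0.
  have hc i : continuous (h i) by rewrite /h; case: (i \in PP) => // t; exact: cvg_cst.
  have h0 i t : 0 <= h i t by rewrite /h; case: ifP => // iP; exact/psd_qform_ge0/hQ.
  have mD : measurable (`[0, +oo[%classic : set R) by exact: measurable_itv.
  have mh i : measurable_fun (`[0, +oo[%classic : set R) (EFin \o h i).
    exact: measurable_EFin_continuous.
  have -> : (\sum_(i in PP) \int[mu]_(t in `[0%R, +oo[)
      (qform ((C i)^T *m Q i *m C i) (y t))%:E =
      \int[mu]_(t in `[0%R, +oo[) \sum_i (EFin \o h i) t)%E.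
    rewrite ge0_integral_sum//; last by move=> i t _; rewrite lee_fin.
    rewrite big_mkcond/=; apply: eq_bigr => i _; rewrite /h.
    by case: (i \in PP) => //; rewrite integral0.
  have mh_sum : measurable_fun (`[0, +oo[%classic : set R)
    (fun t => \sum_i (EFin \o h i) t)%E by exact: emeasurable_sum.
  have h_sum0 t : `[0, +oo[%classic t -> (0 <= \sum_i (EFin \o h i) t)%E.
    by move=> _; apply: sume_ge0 => i _; rewrite lee_fin.
  rewrite -ge0_integralZl ?lee_fin ?invr_ge0//.
  apply: eq_integral => t _; rewrite qformZ qform_sum EFinM; congr (_ * _)%E.
  by rewrite sumEFin /h -big_mkcond.
have bound T : 0 < T -> \int[mu]_(t in `[0, T]) qform Mp (y t) <=
    sdp_objective delta gamma - qform P (y T).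
  move=> T0; rewrite (storage_identity yu yc PT PB T0).
  pose g t := \sum_k gamma k 0 * qform (Sm k) (y t).
  have gk k : mu.-integrable `[0, T] (EFin \o (fun t => gamma k 0 * qform (Sm k) (y t))).
    by apply: integrable_scaler => //; exact: qi.
  have gi : mu.-integrable `[0, T] (EFin \o g) by exact: integrable_sumr.
  apply: (@le_trans _ _ (\int[mu]_(t in `[0, T]) (g t - qform (A^T *m P + P *m A) (y t)))).
    apply: le_Rintegral => //.
    - rewrite (_ : _ \o _ = ((EFin \o g) \-
          (EFin \o (fun t => qform (A^T *m P + P *m A) (y t))%R))%E)//.
      by apply: integrableB => //; exact: qi.
    - move=> t _; have := K (y t).
      rewrite /sdp_Gamma -/Mp qformD [qform (Mp - _) _]qformD qformN qform_sum.
      under eq_bigr do rewrite qformZ.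
      by rewrite -/(g t); lra.
  rewrite RintegralB//.
  rewrite lerD2r Rintegral_sumr// ler_sum// => k _.
  by rewrite RintegralZl ?ler_wpM2l//; exact: qi.
rewrite objE; apply: integral_halfline_le => // e T0 e0.
have den0 : 0 < mxabs P + 1 by rewrite ltr_wpDl ?mxabs_ge0.
(* For a state of size l <= 1 one has l^2 <= l, so |P| l^2 <= |P| e / (|P| + 1) <= e. Below,
   [Num.max T0 1] keeps [T] positive. *)
have eta0 : 0 < Num.min 1 (e / (mxabs P + 1)) by rewrite lt_min ltr01 divr_gt0.
have [T TT0 yT] := hurwitz_state_small yu yc hA (vanishing_l1norm u0) (Num.max T0 1) eta0.
move: TT0; rewrite ge_max => /andP[T0T T1].
exists T => //; apply: le_trans (bound T (lt_le_trans ltr01 T1)) _.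
rewrite lerD2l; apply: (le_trans (ler_norm _)); rewrite normrN.
apply: (le_trans (qform_le_l1norm P (y T))).
move: yT; rewrite le_min => /andP[y1]; rewrite ler_pdivlMr// => ye.
have := l1norm_ge0 (y T); have := mxabs_ge0 P.
set l := l1norm (y T) in y1 ye *; set q := mxabs P in ye * => q0 l0.
have : q * l ^+ 2 <= q * l by rewrite ler_wpM2l// expr2 ler_piMr.
nra.
Qed.

End WeakDuality.

Theorem theorem12 (R : realType) (N n m : nat) (p : 'I_N -> nat)
    (PP MM : {set 'I_N})
    (A : 'M[R]_n) (B : 'M[R]_(n, m)) (C : forall i, 'M[R]_(p i, n))
    (Q S : forall i, 'M[R]_(p i)) (delta : 'I_N -> R)
    (hN : (2 <= N)%N)
    (hPP : PP != finset.set0) (hMM : MM != finset.set0)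
    (hdisj : [disjoint PP & MM]) (hcover : PP :|: MM = finset.setT)
    (hA : hurwitz A) (hAB : controllable A B)
    (hQ : forall i, i \in PP -> psdmx (Q i))
    (hS : forall j, j \in MM -> psdmx (S j))
    (hdelta : forall j, j \in MM -> 0 < delta j) :
  let Cp := (Num.sqrt #|PP|%:R)^-1 *: stacked_output C Q PP in
  let Cm := stacked_output C S MM in
  (op_value PP MM A B C Q S delta <= sdp_value PP MM A B C Q S delta)%E /\
  ((exists beta : R[i],
      [/\ complex.Re beta = 0, is_zero A B Cm 0 beta & ~ is_zero A B Cp 0 beta])
   -> sdp_value PP MM A B C Q S delta = +oo%E).
Proof.
move=> Cp Cm; split.
  apply: ge_ereal_sup => _ [u [x [ux ->]]].
  apply: le_ereal_inf_tmp => _ [gamma [P [gP ->]]].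
  exact: weak_duality ux gP.
move=> [beta [beta0 zm nzp]]; apply/ereal_inf_pinfty => J [gamma [P [gP _]]].
by have := sdp_infeasible_of_zero hPP hQ hS beta0 zm nzp gP.
Qed.
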